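(* Let $X$ and $Y$ be Banach spaces. If $a\in\mathrm{dent}(B_X)$ and $b\in\mathrm{SCD}(B_Y)\setminus\{0\}$, then $a\otimes b\in\mathrm{SCD}\bigl(B_{X\widehat{\otimes}_\pi Y}\bigr)$.
   Context: Banach spaces are over $\mathbb{K}=\mathbb{R}$ or $\mathbb{C}$; $B_X$ and $X^*$ denote the closed unit ball and the topological dual of $X$. A slice of a bounded set $A\subseteq X$ is a non-empty intersection of $A$ with an open half-space; it can be written as $S(A,x^*,\alpha)=\{x\in A:\operatorname{Re}x^*(x)>\sup_{b\in A}\operatorname{Re}x^*(b)-\alpha\}$ with $x^*\in X^*$, $\alpha>0$. Let $A\subseteq X$ be bounded and convex and $a\in A$. A countable collection $\{V_n:n\in\mathbb{N}\}$ of non-empty subsets of $A$ is determining for $a$ if $a\in\overline{\mathrm{conv}}(B)$ whenever $B\subseteq A$ intersects all the sets $V_n$. The point $a$ is an SCD point (slicely countably determined point) of $A$ if there is a sequence of slices of $A$ that is determining for $a$; $\mathrm{SCD}(A)$ is the set of all SCD points of $A$. A point $x\in A$ is a denting point of $A$ if for every $\varepsilon>0$ there is a slice $S$ of $A$ with $x\in S$ and $\mathrm{diam}(S)\le\varepsilon$; $\mathrm{dent}(A)$ is the set of denting points of $A$. The projective tensor product $X\widehat{\otimes}_\pi Y$ is the completion of the algebraic tensor product $X\otimes Y$ under the norm $\|u\|=\inf\{\sum_{i=1}^n\|x_i\|\|y_i\|:u=\sum_{i=1}^n x_i\otimes y_i\}$. *)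

(* Defs.v *)
From HB Require Import structures.
From mathcomp Require Import all_boot all_order all_algebra complex generic_quotient ring_quotient.
From mathcomp Require Import freeg.
From mathcomp Require Import all_classical all_reals all_analysis.

Set Implicit Arguments.
Unset Strict Implicit.
Unset Printing Implicit Defensive.

Import Order.TTheory GRing.Theory Num.Theory.
Import numFieldNormedType.Exports.

Local Open Scope classical_set_scope.
Local Open Scope ring_scope.

Variant scalar_kind := RealScalars | ComplexScalars.

Definition scalars (R : realType) (k : scalar_kind) : numFieldType :=
  match k with RealScalars => R | ComplexScalars => R[i] end.

Definition scalar_re (R : realType) (k : scalar_kind) : scalars R k -> R :=
  match k with RealScalars => id | ComplexScalars => @complex.Re R end.
Arguments scalar_re {R k} _.

(** The norm of a [normedModType K] takes its values in [K]; [rnorm] is the same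
    number seen in [R]. *)
Definition rnorm (R : realType) (k : scalar_kind)
  (X : normedModType (scalars R k)) (x : X) : R := scalar_re `|x|.

Section Slices.
Variables (R : realType) (k : scalar_kind) (X : normedModType (scalars R k)).
Local Notation K := (scalars R k).
Implicit Types (A B S : set X) (a x : X).

Definition unit_ball : set X := [set x | rnorm x <= 1].

Definition slice A (f : X -> K^o) (alpha : R) : set X :=
  [set x | A x /\
    sup [set scalar_re (f b) | b in A] - alpha < scalar_re (f x)].

Definition is_slice A S :=
  S !=set0 /\
  exists f : {linear X -> K^o}, continuous f /\
    exists2 alpha : R, 0 < alpha & S = slice A f alpha.

Definition diam S : \bar R :=
  ereal_sup [set (rnorm (p.1 - p.2))%:E | p in S `*` S].

Definition dent A : set X :=
  [set x | A x /\
    forall eps : R, 0 < eps ->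
      exists S, [/\ is_slice A S, S x & (diam S <= eps%:E)%E]].

(** Real and complex convexity coincide here: [l : {i01 K}] forces [l] to be
    real, because [0 <= l] does so in the order of [R[i]]. *)
Definition conv_hull B : set X := smallest (@convex_set K X) B.

Definition determining A a (V : nat -> set X) :=
  (forall n, V n `<=` A /\ V n !=set0) /\
  forall B, B `<=` A -> (forall n, B `&` V n !=set0) ->
    closure (conv_hull B) a.

Definition SCD A : set X :=
  [set a | A a /\
    exists V : nat -> set X, (forall n, is_slice A (V n)) /\ determining A a V].

End Slices.
Arguments unit_ball {R k} X.

(** The algebraic tensor product: the free vector space on [X * Y] modulo the
    subspace spanned by the bilinearity relations. *)
Section AlgebraicTensor.
Variables (K : fieldType) (X Y : lmodType K).
Local Notation free := {freeg (X * Y)%type / K}.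

Let gen (x : X) (y : Y) : free := << (x, y) >>%R.

Inductive tensor_rel : free -> Prop :=
| tensor_rel0 : tensor_rel 0
| tensor_relD u v : tensor_rel u -> tensor_rel v -> tensor_rel (u + v)
| tensor_relZ c u : tensor_rel u -> tensor_rel (c *: u)
| tensor_relDl x1 x2 y : tensor_rel (gen (x1 + x2) y - (gen x1 y + gen x2 y))
| tensor_relDr x y1 y2 : tensor_rel (gen x (y1 + y2) - (gen x y1 + gen x y2))
| tensor_relZl c x y : tensor_rel (gen (c *: x) y - c *: gen x y)
| tensor_relZr c x y : tensor_rel (gen x (c *: y) - c *: gen x y).

Definition tensor_ker : {pred free} := fun u => `[< tensor_rel u >].

Lemma tensor_ker_zmod : zmod_closed tensor_ker.
Proof.
split=> [|u v /asboolP ru /asboolP rv]; apply/asboolP; first exact: tensor_rel0.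
by apply: tensor_relD => //; rewrite -scaleN1r; exact: tensor_relZ.
Qed.
HB.instance Definition _ := GRing.isZmodClosed.Build free tensor_ker tensor_ker_zmod.

Definition tensor := Quotient.quot tensor_ker.
HB.instance Definition _ := GRing.Zmodule.on tensor.

Local Notation pi := (\pi_(Quotient.quot tensor_ker)%qT : free -> tensor).

Definition tensor_scale (c : K) (u : tensor) : tensor :=
  pi (c *: (repr u : free)).

Lemma piZ c (u : free) : pi (c *: u) = tensor_scale c (pi u).
Proof.
rewrite /tensor_scale; apply/eqP; rewrite -Quotient.idealrBE -scalerBr.
apply/asboolP/tensor_relZ/asboolP.
change (u - repr (pi u) \in tensor_ker).
by rewrite Quotient.idealrBE reprK.
Qed.

Lemma piD (u v : free) : pi (u + v) = pi u + pi v.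
Proof. exact: raddfD. Qed.

Lemma piP (u : tensor) : exists v : free, u = pi v.
Proof. by exists (repr u); rewrite reprK. Qed.

Lemma tensor_scaleA c d u :
  tensor_scale c (tensor_scale d u) = tensor_scale (c * d) u.
Proof. by have [v ->] := piP u; rewrite -!piZ scalerA. Qed.

Lemma tensor_scale1 : left_id 1 tensor_scale.
Proof. by move=> u; have [v ->] := piP u; rewrite -!piZ scale1r. Qed.

Lemma tensor_scaleDr : right_distributive tensor_scale +%R.
Proof.
move=> c u v; have [u' ->] := piP u; have [v' ->] := piP v.
by rewrite -piD -!piZ scalerDr piD.
Qed.

Lemma tensor_scaleDl u : {morph tensor_scale^~ u : c d / c + d}.
Proof. by move=> c d; have [v ->] := piP u; rewrite -!piZ scalerDl piD. Qed.

HB.instance Definition _ := GRing.Zmodule_isLmodule.Build K tensor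
  tensor_scaleA tensor_scale1 tensor_scaleDr tensor_scaleDl.

Definition tens (x : X) (y : Y) : tensor := pi (gen x y).

Lemma pi_eq (u v : free) : tensor_rel (u - v) -> pi u = pi v.
Proof. by move=> r; apply/eqP; rewrite -Quotient.idealrBE; apply/asboolP. Qed.

Lemma tensDl x1 x2 y : tens (x1 + x2) y = tens x1 y + tens x2 y.
Proof. by rewrite /tens -piD; apply/pi_eq/tensor_relDl. Qed.

Lemma tensDr x y1 y2 : tens x (y1 + y2) = tens x y1 + tens x y2.
Proof. by rewrite /tens -piD; apply/pi_eq/tensor_relDr. Qed.

Lemma tensZl c x y : tens (c *: x) y = c *: tens x y.
Proof. by rewrite /tens [RHS](esym (piZ _ _)); apply/pi_eq/tensor_relZl. Qed.

Lemma tensZr c x y : tens x (c *: y) = c *: tens x y.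
Proof. by rewrite /tens [RHS](esym (piZ _ _)); apply/pi_eq/tensor_relZr. Qed.

Lemma tens_span (u : tensor) :
  exists n (x : 'I_n -> X) (y : 'I_n -> Y), u = \sum_(i < n) tens (x i) (y i).
Proof.
have [v ->] := piP u; elim/freeg_ind_dom0: v => [|c [x y] v _ _ [n [xs [ys e]]]].
  by exists 0%N, (fun=> 0), (fun=> 0); rewrite big_ord0 raddf0.
have gE : << c *g (x, y) >> = c *: gen x y :> free.
  by apply/eqP/freeg_eqP => z; rewrite coeffZ !coeffU mul1r.
exists n.+1, (fun i => if unlift ord0 i is Some j then xs j else c *: x),
  (fun i => if unlift ord0 i is Some j then ys j else y).
rewrite big_ord_recl unlift_none gE piD e tensZl [X in X + _]piZ; congr (_ + _).
by apply: eq_bigr => i _; rewrite !liftK.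
Qed.

Lemma tens_lift (W : lmodType K) (B : X -> Y -> W) :
  bilinear_for *:%R *:%R B ->
  exists f : {linear tensor -> W}, forall x y, f (tens x y) = B x y.
Proof.
move=> [Bl Br]; pose g : free -> W := fglift (fun p => B p.1 p.2).
have gB u v : g (u - v) = g u - g v by exact: lift_is_additive.
have gU c x y : g << c *g (x, y) >> = c *: B x y by rewrite /g liftU.
have g0 : g 0 = 0 by rewrite -(subrr 0) gB subrr.
have gD u v : g (u + v) = g u + g v.
  by rewrite -[v in LHS]opprK gB -[- v]sub0r gB g0 sub0r opprK.
have gZ c u : g (c *: u) = c *: g u.
  elim/freeg_ind_dom0: u => [|d [x y] v _ _ IH]; first by rewrite scaler0 g0 scaler0.
  have -> : c *: (<< d *g (x, y) >> + v) = << c * d *g (x, y) >> + c *: v.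
    rewrite scalerDr; congr (_ + _).
    by apply/eqP/freeg_eqP => z; rewrite coeffZ !coeffU mulrA.
  by rewrite !gD !gU IH scalerDr scalerA.
have BD1 x1 x2 y : B (x1 + x2) y = B x1 y + B x2 y.
  by have := Bl y 1 x1 x2; rewrite /= !scale1r.
have BD2 x y1 y2 : B x (y1 + y2) = B x y1 + B x y2.
  by have := Br x 1 y1 y2; rewrite /= !scale1r.
have B0l y : B 0 y = 0.
  by apply: (addrI (B 0 y)); rewrite -BD1 !addr0.
have B0r x : B x 0 = 0.
  by apply: (addrI (B x 0)); rewrite -BD2 !addr0.
have BZ1 c x y : B (c *: x) y = c *: B x y.
  by have := Bl y c x 0; rewrite /= addr0 B0l addr0.
have BZ2 c x y : B x (c *: y) = c *: B x y.
  by have := Br x c y 0; rewrite /= addr0 B0r addr0.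
have gE x y : g (gen x y) = B x y by rewrite gU scale1r.
have g_rel u : tensor_rel u -> g u = 0.
  elim=> //=.
  - by move=> ? ? _ e1 _ e2; rewrite gD e1 e2 addr0.
  - by move=> ? ? _ e; rewrite gZ e scaler0.
  - by move=> *; rewrite gB gD !gE BD1 subrr.
  - by move=> *; rewrite gB gD !gE BD2 subrr.
  - by move=> *; rewrite gB gZ !gE BZ1 subrr.
  - by move=> *; rewrite gB gZ !gE BZ2 subrr.
pose f (u : tensor) : W := g (repr u).
have fpi (u : free) : f (pi u) = g u.
  apply/eqP; rewrite -subr_eq0 -gB; apply/eqP/g_rel/asboolP.
  change (repr (pi u) - u \in tensor_ker).
  by rewrite Quotient.idealrBE reprK.
have f_lin : linear f.
  move=> c u v; have [u' ->] := piP u; have [v' ->] := piP v.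
  by rewrite -[c *: pi u'](piZ c u') -piD !fpi gD gZ.
pose F : {linear tensor -> W} := HB.pack f (GRing.isLinear.Build K tensor W *:%R f f_lin).
by exists F => x y; rewrite /= fpi gE.
Qed.

End AlgebraicTensor.

Section ProjectiveTensor.
Variables (R : realType) (k : scalar_kind).
Local Notation K := (scalars R k).
Variables X Y : normedModType K.

Definition proj_norm (u : tensor X Y) : R :=
  inf [set r | exists n (x : 'I_n -> X) (y : 'I_n -> Y),
    u = \sum_(i < n) tens (x i) (y i) /\
    r = \sum_(i < n) rnorm (x i) * rnorm (y i)].

(** [Z], with the embedding [iota], is the completion of the algebraic tensor
    product for [proj_norm]. This determines [Z] up to an isometric isomorphism
    that commutes with the embeddings. *)
Definition is_proj_tensor (Z : completeNormedModType K)
    (iota : {linear tensor X Y -> Z}) :=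
  (forall u, rnorm (iota u) = proj_norm u) /\ dense (range iota).

End ProjectiveTensor.

(* Main.v *)
Require Import Defs.
From HB Require Import structures.
From mathcomp Require Import all_boot all_order all_algebra complex.
From mathcomp Require Import all_classical all_reals all_analysis.
From mathcomp Require Import ring lra.

Set Implicit Arguments.
Unset Strict Implicit.
Unset Printing Implicit Defensive.

Import Order.TTheory GRing.Theory Num.Theory.
Import numFieldNormedType.Exports.

Local Open Scope classical_set_scope.
Local Open Scope ring_scope.

(** The proof is an averaging argument. If [f] and
    [h] are functionals of norm one on [X] and [Y], then [f (x) h] extends from
    the algebraic tensor product to a functional of norm one on [Z]
    ([product_functional]). A point [z] of the unit ball of [Z] where it is
    almost 1 is close to a finite sum of elementary tensors of total weight
    almost 1. Since no elementary tensor can contribute more than its weight,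
    those that contribute much less than their weight are negligible, and in
    each of the others both normalized factors lie, after a rotation by a
    scalar, in given slices defined by [f] and [h]
    ([elementary_tensor_near]). If the slice defined by [f] is a small one
    around the denting point [a], the first factors may all be replaced by [a],
    so that [z] is close to [a (x) y] with [y] a convex combination of points
    of the slice of [Y] ([sum_tensor_near], [cap_tensor_slice]).

    Let [V n] be a determining sequence of slices for [b]. What precedes gives
    slices [W (n, m)] of the ball of [Z] all of whose points are within
    [1 / (m + 1)] of [a (x) V n]. These are determining for [a (x) b]: if [B]
    contains points [z n] of [W (n, m)], near [a (x) y n] with [y n] in [V n],
    then [b] is a limit of convex combinations of the [y n], and the same
    combinations of the [z n] come within about [1 / (m + 1)] of [a (x) b].

    The slices defined by the zero functional equal the whole ball and need a
    separate treatment. In [X] a small slice of this kind forces [X = 0], hence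
    [Z = 0]; in [Y] such a member of the sequence [V] can be ignored, because
    [b <> 0] provides another member that is not the whole ball
    ([determining_cap]).

    Norms and convex coefficients live in the scalar field, which is real or
    complex; they are compared through the real numbers [rnorm] and
    [scalar_abs]. *)

(** * Real and complex scalars *)

Section ScalarTheory.
Variables (R : realType) (k : scalar_kind).
Local Notation K := (scalars R k).
Implicit Types (r s : R) (c d : K).

Definition real_scalar r : K :=
  match k as k0 return scalars R k0 with
  | RealScalars => r
  | ComplexScalars => (r%:C)%C
  end.

Lemma scalar_re0 : scalar_re (0 : K) = 0. Proof. by case: k. Qed.

Lemma scalar_re1 : scalar_re (1 : K) = 1. Proof. by case: k. Qed.

Lemma scalar_reD c d : scalar_re (c + d) = scalar_re c + scalar_re d.
Proof. by case: k c d => //= [[? ?] [? ?]]. Qed.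

Lemma scalar_reN c : scalar_re (- c) = - scalar_re c.
Proof. by case: k c => //= [[? ?]]. Qed.

Lemma scalar_re_sum n (c : 'I_n -> K) :
  scalar_re (\sum_(i < n) c i) = \sum_(i < n) scalar_re (c i).
Proof. exact: (big_morph _ scalar_reD scalar_re0). Qed.

Lemma scalar_re_real r : scalar_re (real_scalar r) = r.
Proof. by rewrite /real_scalar; case: k. Qed.

Lemma scalar_reM r c : scalar_re (real_scalar r * c) = r * scalar_re c.
Proof.
by rewrite /real_scalar; case: k c => //= [[? ?]] /=; rewrite mul0r subr0.
Qed.

Lemma real_scalar0 : real_scalar 0 = 0.
Proof. by rewrite /real_scalar; case: k. Qed.

Lemma real_scalar1 : real_scalar 1 = 1.
Proof. by rewrite /real_scalar; case: k. Qed.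

Lemma real_scalarD r s : real_scalar (r + s) = real_scalar r + real_scalar s.
Proof. by rewrite /real_scalar; case: k => //=; rewrite rmorphD. Qed.

Lemma real_scalarM r s : real_scalar (r * s) = real_scalar r * real_scalar s.
Proof. by rewrite /real_scalar; case: k => //=; rewrite rmorphM. Qed.

Lemma real_scalarN r : real_scalar (- r) = - real_scalar r.
Proof. by rewrite /real_scalar; case: k => //=; rewrite rmorphN. Qed.

Lemma ler_real_scalar r s : (real_scalar r <= real_scalar s) = (r <= s).
Proof. by rewrite /real_scalar; case: k => //=; rewrite lecR. Qed.

Lemma ltr_real_scalar r s : (real_scalar r < real_scalar s) = (r < s).
Proof. by rewrite /real_scalar; case: k => //=; rewrite ltcR. Qed.

Lemma ger0_real_scalar c : 0 <= c -> c = real_scalar (scalar_re c).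
Proof.
rewrite /real_scalar; case: k c => //= c c0; rewrite RRe_real //.
exact: ger0_real.
Qed.

Definition scalar_abs c : R := scalar_re `|c|.

Lemma norm_scalarE c : `|c| = real_scalar (scalar_abs c).
Proof. exact/ger0_real_scalar/normr_ge0. Qed.

Lemma norm_real_scalar r : `|real_scalar r| = real_scalar `|r|.
Proof.
rewrite /real_scalar; case: k => //=; rewrite normc_def /= expr0n addr0.
by rewrite sqrtr_sqr.
Qed.

Lemma scalar_re_le c : scalar_re c <= scalar_abs c.
Proof.
rewrite -ler_real_scalar -norm_scalarE /real_scalar.
case: k c => [c|c]; first exact: ler_norm.
by apply: le_trans (normc_ge_Re c); rewrite lecR ler_norm.
Qed.

Lemma ger0_scalar_abs c : 0 <= c -> scalar_abs c = scalar_re c.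
Proof. by move=> c0; rewrite /scalar_abs ger0_norm. Qed.

Lemma scalar_absM c d : scalar_abs (c * d) = scalar_abs c * scalar_abs d.
Proof. by rewrite {1}/scalar_abs normrM [X in X * _]norm_scalarE scalar_reM. Qed.

Lemma scalar_abs_real r : scalar_abs (real_scalar r) = `|r|.
Proof. by rewrite /scalar_abs norm_real_scalar scalar_re_real. Qed.

Lemma scalar_phase c : exists2 t : K, `|t| = 1 & t * c = real_scalar (scalar_abs c).
Proof.
have [->|c0] := eqVneq c 0.
  exists 1; first exact: normr1.
  by rewrite mulr0 /scalar_abs normr0 scalar_re0 real_scalar0.
exists (`|c| / c); last by rewrite divfK // norm_scalarE.
by rewrite normf_div normr_id divff // normr_eq0.
Qed.

End ScalarTheory.
Arguments real_scalar {R k} r.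

(** * Real-valued norms *)

Section RealNorm.
Variables (R : realType) (k : scalar_kind).
Local Notation K := (scalars R k).
Variable X : normedModType K.
Implicit Types (x y : X) (r : R) (c : K).

Lemma norm_rnorm x : `|x| = real_scalar (rnorm x).
Proof. exact/ger0_real_scalar/normr_ge0. Qed.

Lemma rnorm_le x r : (`|x| <= real_scalar r) = (rnorm x <= r).
Proof. by rewrite norm_rnorm ler_real_scalar. Qed.

Lemma rnorm_lt x r : (`|x| < real_scalar r) = (rnorm x < r).
Proof. by rewrite norm_rnorm ltr_real_scalar. Qed.

Lemma rnorm_ge0 x : 0 <= rnorm x.
Proof. by rewrite -(@ler_real_scalar R k) real_scalar0 -norm_rnorm. Qed.

Lemma rnorm0 : rnorm (0 : X) = 0.
Proof. by rewrite /rnorm normr0 scalar_re0. Qed.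

Lemma rnorm_eq0 x : rnorm x = 0 -> x = 0.
Proof.
by move=> x0; apply/eqP; rewrite -normr_eq0 norm_rnorm x0 real_scalar0.
Qed.

Lemma rnormD x y : rnorm (x + y) <= rnorm x + rnorm y.
Proof. by rewrite -rnorm_le real_scalarD -!norm_rnorm ler_normD. Qed.

Lemma rnormN x : rnorm (- x) = rnorm x.
Proof. by rewrite /rnorm normrN. Qed.

Lemma rnorm_distC x y : rnorm (x - y) = rnorm (y - x).
Proof. by rewrite -rnormN opprB. Qed.

Lemma rnorm_triangle y x z : rnorm (x - z) <= rnorm (x - y) + rnorm (y - z).
Proof. by apply: le_trans (rnormD _ _); rewrite addrA subrK. Qed.

Lemma rnormZ c x : rnorm (c *: x) = scalar_abs c * rnorm x.
Proof.
by rewrite {1}/rnorm normrZ [X in X * _]norm_scalarE scalar_reM.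
Qed.

Lemma rnormZ_real r x : 0 <= r -> rnorm (real_scalar r *: x) = r * rnorm x.
Proof.
by move=> r0; rewrite rnormZ scalar_abs_real ger0_norm.
Qed.

Lemma rnorm_sum n (x : 'I_n -> X) (P : pred 'I_n) :
  rnorm (\sum_(i < n | P i) x i) <= \sum_(i < n | P i) rnorm (x i).
Proof.
elim/big_rec2: _ => [|i y s _ le_ys]; first by rewrite rnorm0.
by apply: le_trans (rnormD _ _) _; rewrite lerD2l.
Qed.

Lemma rnorm_small0 x : (forall e : R, 0 < e -> rnorm x <= e) -> x = 0.
Proof.
move=> small; apply: rnorm_eq0; apply/eqP; rewrite eq_le rnorm_ge0 andbT.
by apply/ler_addgt0Pl => e e0; rewrite addr0 small.
Qed.

Lemma nbhs_rnormP x (A : set X) :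
  nbhs x A <-> exists2 e : R, 0 < e & forall y, rnorm (x - y) < e -> A y.
Proof.
split=> [/nbhs_normP[e /= e0 eA]|[e e0 eA]].
  exists (scalar_re e) => [|y xy].
    by rewrite -(@ltr_real_scalar R k) real_scalar0 -ger0_real_scalar // ltW.
  by apply: eA; rewrite /ball_ /= (ger0_real_scalar (ltW e0)) rnorm_lt.
apply/nbhs_normP; exists (real_scalar e) => [|y /=].
  by rewrite /= -real_scalar0 ltr_real_scalar.
by rewrite rnorm_lt => /eA.
Qed.

Lemma closure_rnormP (A : set X) x :
  closure A x <-> forall e : R, 0 < e -> exists2 y, A y & rnorm (x - y) < e.
Proof.
split=> [cl e e0|cl B /nbhs_rnormP[e e0 eB]]; last first.
  by have [y Ay /eB By] := cl e e0; exists y.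
have /cl[y [Ay ?]] : nbhs x [set y | rnorm (x - y) < e].
  by apply/nbhs_rnormP; exists e.
by exists y.
Qed.

Lemma dense_rnormP (A : set X) : dense A ->
  forall x (e : R), 0 < e -> exists2 y, A y & rnorm (x - y) < e.
Proof.
move=> dA x e e0.
have [|y [/interior_subset xy Ay]] := dA (interior [set y | rnorm (x - y) < e]) _ (@open_interior _ _).
  by exists x; apply/nbhs_rnormP; exists e.
by exists y.
Qed.

End RealNorm.

(** * Slices of the unit ball and functionals of norm one *)

Lemma functionalZ (K : numFieldType) (V : lmodType K) (f : {linear V -> K^o}) c x :
  f (c *: x) = c * f x.
Proof. exact: linearZ. Qed.

Section UnitFunctionals.
Variables (R : realType) (k : scalar_kind).
Local Notation K := (scalars R k).
Variable X : normedModType K.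
Implicit Types (x y : X) (f : {linear X -> K^o}).

Lemma unit_ball0 : unit_ball X 0.
Proof. by rewrite /unit_ball /= rnorm0 ler01. Qed.

Lemma contraction_continuous f :
  (forall x, scalar_abs (f x) <= rnorm x) -> continuous f.
Proof.
move=> f_le x A /nbhs_rnormP[e e0 eA]; apply/nbhs_rnormP; exists e => // y xy.
by apply: eA; rewrite -linearB; apply: le_lt_trans (f_le _) xy.
Qed.

Lemma continuous_rnorm_bounded f : continuous f ->
  exists2 C : R, 0 <= C & forall x, scalar_abs (f x) <= C * rnorm x.
Proof.
move=> /linear_bounded_continuous/linear_boundedP/pinfty_ex_gt0[C C0 fC].
exists (scalar_re C) => [|x].
  by rewrite -(@ler_real_scalar R k) real_scalar0 -ger0_real_scalar // ltW.
rewrite -(@ler_real_scalar R k) -norm_scalarE real_scalarM -norm_rnorm.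
by rewrite -ger0_real_scalar ?fC // ltW.
Qed.

(** A functional of norm one. The lower bound is put on real parts, because
    slices are defined by them. *)
Definition unit_functional f :=
  (forall x, scalar_abs (f x) <= rnorm x) /\
  forall e : R, 0 < e -> exists2 x, unit_ball X x & 1 - e < scalar_re (f x).

(** The slice in normalized form: as the supremum of [f] over the ball is 1,
    there is no supremum left to compute. *)
Definition cap f (t : R) : set X :=
  [set x | unit_ball X x /\ 1 - t < scalar_re (f x)].

Lemma unit_functional_le f x : unit_functional f -> unit_ball X x ->
  scalar_re (f x) <= 1.
Proof.
by case=> f_le _; apply: le_trans; apply: le_trans (scalar_re_le _) (f_le x).
Qed.

Lemma sup_unit_functional f : unit_functional f ->
  sup [set scalar_re (f x) | x in unit_ball X] = 1.
Proof.
move=> uf; have ub1 : ubound [set scalar_re (f x) | x in unit_ball X] 1.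
  by move=> _ [x x1 <-]; exact: unit_functional_le.
apply/eqP; rewrite eq_le ge_sup //=; last first.
  by exists (scalar_re (f 0)), 0 => //; exact: unit_ball0.
apply/ler_addgt0Pl => e e0; have [x x1 lt_x] := uf.2 e e0.
rewrite -lerBlDl; apply: ltW; apply: lt_le_trans lt_x _.
by apply: ub_le_sup; [exists 1 | exists x].
Qed.

Lemma cap_slice f t : unit_functional f -> 0 < t -> is_slice (unit_ball X) (cap f t).
Proof.
move=> uf t0; split; first by have [x x1 ?] := uf.2 t t0; exists x.
exists f; split; first exact/contraction_continuous/(proj1 uf).
by exists t => //; rewrite /slice sup_unit_functional.
Qed.

Lemma ball_slice : is_slice (unit_ball X) (unit_ball X).
Proof.
split; first by exists 0; exact: unit_ball0.
exists \0; split; first exact: cst_continuous.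
have re0 y : scalar_re ((\0 : {linear X -> K^o}) y) = 0 by exact: (scalar_re0 R k).
exists 1 => //; apply/seteqP; split=> [x x1|x []//]; split=> //.
rewrite re0; set E := image _ _; suff -> : E = [set 0] by rewrite sup1; lra.
apply/seteqP; split=> [_ [y _ <-] //|_ ->].
by exists 0; first exact: unit_ball0.
Qed.

(** Rotating and normalizing a point turns a bound for the real part of a
    functional on the ball into a bound for its absolute value. *)
Lemma abs_le_of_re_le f (N : R) : (forall x, unit_ball X x -> scalar_re (f x) <= N) ->
  forall x, scalar_abs (f x) <= N * rnorm x.
Proof.
move=> fN x; have [x0|x0] := eqVneq (rnorm x) 0.
  by rewrite (rnorm_eq0 x0) linear0 rnorm0 mulr0 ger0_scalar_abs // scalar_re0.
have xgt0 : 0 < rnorm x by rewrite lt_def x0 rnorm_ge0.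
have [t t1 tf] := scalar_phase (f x).
rewrite -ler_pdivrMr // mulrC.
have := fN (real_scalar (rnorm x)^-1 *: (t *: x)).
rewrite !functionalZ tf scalar_reM scalar_re_real.
apply; rewrite /unit_ball /= rnormZ_real ?invr_ge0 ?rnorm_ge0 // rnormZ.
by rewrite /scalar_abs t1 scalar_re1 mul1r mulVf.
Qed.

(** Dividing the functional by its supremum [N] over the ball gives it norm one;
    this fails only for [N = 0], where the functional vanishes. *)
Lemma ball_sliceP S : is_slice (unit_ball X) S ->
  S = unit_ball X \/ exists f t, [/\ unit_functional f, 0 < t & S = cap f t].
Proof.
case=> _ [f [/continuous_rnorm_bounded[C C0 fC] [a a0 ->]]].
rewrite /slice; set E := image _ _; set N := sup E.
have ubE : has_ubound E.
  exists C => _ [x x1 <-]; apply: le_trans (scalar_re_le _) _.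
  by apply: le_trans (fC x) _; rewrite ler_piMr.
have fN x : unit_ball X x -> scalar_re (f x) <= N.
  by move=> x1; apply: ub_le_sup => //; exists x.
have E0 : E 0 by exists 0; [exact: unit_ball0 | rewrite linear0 scalar_re0].
have N0 : 0 <= N by apply: ub_le_sup.
have [Nz|Nnz] := eqVneq N 0.
  left; apply/seteqP; split=> [x []//|x x1]; split=> //.
  have : scalar_re (f (- x)) <= 0 by rewrite -Nz fN // /unit_ball /= rnormN.
  by rewrite Nz linearN scalar_reN; lra.
have {Nnz}Npos : 0 < N by rewrite lt_def Nnz.
right; exists (real_scalar N^-1 \*: f), (a / N).
have gE x : scalar_re ((real_scalar N^-1 \*: f) x) = scalar_re (f x) / N.
  by rewrite /= -[_ *: f x]/(_ * f x) scalar_reM mulrC.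
split; last 2 first.
- by rewrite divr_gt0.
- have depthE x : (1 - a / N < scalar_re ((real_scalar N^-1 \*: f) x)) =
      (N - a < scalar_re (f x)).
    by rewrite gE ltr_pdivlMr // mulrBl mul1r divfK ?gt_eqF.
  by apply/seteqP; split=> x [x1 fx]; split => //; move: fx; rewrite depthE.
split=> [x|e e0].
  rewrite [scalar_abs _](_ : _ = N^-1 * scalar_abs (f x)); last first.
    rewrite [LHS]scalar_absM scalar_abs_real ger0_norm // invr_ge0 ltW //.
  by rewrite mulrC ler_pdivrMr // mulrC abs_le_of_re_le.
have [||_ [x x1 <-] Nx] := @sup_adherent R E (e * N); first by rewrite mulr_gt0.
  by split => //; exists 0.
by exists x => //; rewrite gE ltr_pdivlMr // mulrBl mul1r.
Qed.

End UnitFunctionals.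

(** * Extending a functional from a dense subspace *)

Section RealExtension.
Variables (R : realType) (k : scalar_kind).
Local Notation K := (scalars R k).
Variable Z : normedModType K.

(** The admissible value is the best lower bound that the Lipschitz condition
    imposes, as in McShane's extension theorem. *)
Lemma lipschitz_value (V : Type) (v0 : V) (j : V -> Z) (phi : V -> R) (z : Z) :
  (forall u v, phi u - phi v <= rnorm (j u - j v)) ->
  exists r, forall u, `|r - phi u| <= rnorm (z - j u).
Proof.
move=> lip; pose E := range (fun u => phi u - rnorm (z - j u)).
have leE u v : phi u - rnorm (z - j u) <= phi v + rnorm (z - j v).
  have := rnorm_triangle z (j u) (j v); rewrite (rnorm_distC (j u) z).
  by have := lip u v; lra.
have supE u : phi u - rnorm (z - j u) <= sup E.
  apply: ub_le_sup; last by exists u.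
  by exists (phi v0 + rnorm (z - j v0)) => _ [v _ <-].
exists (sup E) => u; rewrite ler_norml lerBrDr addrC supE /= lerBlDl.
by apply: ge_sup => [|_ [v _ <-] //]; exists (phi v0 - rnorm (z - j v0)), v0.
Qed.

End RealExtension.

Section Extension.
Variables (R : realType) (k : scalar_kind).
Local Notation K := (scalars R k).
Variable Z : normedModType K.

Lemma sqrt_sum_sqr_bounds (a b : R) :
  [/\ `|a| <= Num.sqrt (a ^+ 2 + b ^+ 2), `|b| <= Num.sqrt (a ^+ 2 + b ^+ 2)
    & Num.sqrt (a ^+ 2 + b ^+ 2) <= `|a| + `|b|].
Proof.
have ab0 : 0 <= a ^+ 2 + b ^+ 2 by rewrite addr_ge0 ?sqr_ge0.
split; rewrite -?[X in X <= _]sqrtr_sqr ?ler_wsqrtr ?lerDl ?lerDr ?sqr_ge0 //.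
rewrite -[leRHS]ger0_norm ?addr_ge0 // -[leRHS]sqrtr_sqr ler_wsqrtr //.
rewrite sqrrD !real_normK ?num_real // addrAC lerDl mulrn_wge0 // mulr_ge0 //.
Qed.

(** Over the complex numbers the real and imaginary parts are treated
    separately, which costs the factor 2. *)
Lemma scalar_lipschitz_value (V : Type) (v0 : V) (j : V -> Z) (phi : V -> K) (z : Z) :
  (forall u v, scalar_abs (phi u - phi v) <= rnorm (j u - j v)) ->
  exists c, forall u, scalar_abs (c - phi u) <= 2 * rnorm (z - j u).
Proof.
case: k Z j phi z => Z' j phi z lip.
  have [u v|r rP] := @lipschitz_value R RealScalars Z' V v0 j phi z.
    by apply: le_trans (ler_norm _) (lip u v).
  by exists r => u; apply: le_trans (rP u) _; rewrite ler_peMl ?rnorm_ge0 ?ler1n.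
have absE (c : R[i]) : @scalar_abs R ComplexScalars c =
    Num.sqrt (complex.Re c ^+ 2 + complex.Im c ^+ 2).
  by rewrite /scalar_abs normc_def.
have [u v|r rP] :=
    @lipschitz_value R ComplexScalars Z' V v0 j (fun u => complex.Re (phi u)) z.
  rewrite -raddfB; apply: le_trans (lip u v); rewrite absE.
  by have [+ _ _] := sqrt_sum_sqr_bounds (complex.Re (phi u - phi v))
    (complex.Im (phi u - phi v)); apply: le_trans; exact: ler_norm.
have [u v|s sP] :=
    @lipschitz_value R ComplexScalars Z' V v0 j (fun u => complex.Im (phi u)) z.
  rewrite -raddfB; apply: le_trans (lip u v); rewrite absE.
  by have [_ + _] := sqrt_sum_sqr_bounds (complex.Re (phi u - phi v))
    (complex.Im (phi u - phi v)); apply: le_trans; exact: ler_norm.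
exists (Complex r s) => u; rewrite absE !raddfB /=.
have [_ _ /le_trans] := sqrt_sum_sqr_bounds (r - complex.Re (phi u)) (s - complex.Im (phi u)).
by apply; rewrite mulrDl !mul1r lerD.
Qed.

(** The value at [z] is pinned down by the values on the dense image of [j], so
    the pointwise choices fit together linearly. The loss of a factor 2 in the
    choice of these values is only apparent, since it multiplies a distance to
    the image of [j], which can be made arbitrarily small. *)
Lemma dense_extension (V : lmodType K) (j : {linear V -> Z}) (phi : {linear V -> K^o}) :
  dense (range j) -> (forall u, scalar_abs (phi u) <= rnorm (j u)) ->
  exists f : {linear Z -> K^o}, (forall u, f (j u) = phi u) /\
    forall z, scalar_abs (f z) <= rnorm z.
Proof.
move=> dj phi_le.
have /choice[f fP] z : exists c, forall u, scalar_abs (c - phi u) <= 2 * rnorm (z - j u).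
  by apply: (scalar_lipschitz_value 0) => u v; rewrite -!linearB.
have approx z (e : R) : 0 < e -> exists u, rnorm (z - j u) < e.
  by move=> e0; have [_ [u _ <-] ?] := dense_rnormP dj z e0; exists u.
have absD (c d : K) : scalar_abs (c + d) <= scalar_abs c + scalar_abs d.
  exact: (@rnormD R k K^o).
have f_lin : linear (f : Z -> K^o).
  move=> c z w; apply/eqP; rewrite -subr_eq0; apply/eqP.
  apply: (@rnorm_small0 R k K^o) => e e0.
  have C0 : 0 <= scalar_abs c by exact: (@rnorm_ge0 R k K^o).
  pose d := e / (4 * (scalar_abs c + 1)).
  have d0 : 0 < d by rewrite divr_gt0 // mulr_gt0 // ltr_wpDl.
  have [u zu] := approx z d d0; have [v wv] := approx w d d0.
  have -> : f (c *: z + w) - (c *: (f z : K^o) + f w) =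
      (f (c *: z + w) - phi (c *: u + v)) + ((- c) * (f z - phi u) + (- 1) * (f w - phi v)).
    rewrite (linearD phi) (functionalZ phi).
    by change (f (c *: z + w) - (c * f z + f w) = f (c *: z + w) -
      (c * phi u + phi v) + (- c * (f z - phi u) + - 1 * (f w - phi v))); ring.
  have abs1 : scalar_abs (- 1 : K) = 1 by rewrite /scalar_abs normrN1 scalar_re1.
  have absN (x : K) : scalar_abs (- x) = scalar_abs x by rewrite /scalar_abs normrN.
  apply: le_trans (absD _ _) _.
  apply: le_trans (lerD (lexx _) (absD _ _)) _.
  rewrite !scalar_absM abs1 absN mul1r.
  have h1 := fP (c *: z + w) (c *: u + v).
  have h2 := fP z u; have h3 := fP w v.
  have : rnorm (c *: z + w - j (c *: u + v)) <= scalar_abs c * d + d.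
    rewrite linearD linearZ opprD addrACA -scalerBr.
    by apply: le_trans (rnormD _ _) _; rewrite rnormZ (lerD (ler_wpM2l C0 (ltW zu)) (ltW wv)).
  have e4 : e = 4 * (scalar_abs c + 1) * d by rewrite /d mulrC divfK // gt_eqF // mulr_gt0 // ltr_wpDl.
  nra.
pose F : {linear Z -> K^o} := HB.pack f (GRing.isLinear.Build K Z K^o *:%R f f_lin).
exists F; split=> [u|z] /=.
  apply/eqP; rewrite -subr_eq0; apply/eqP/(@rnorm_small0 R k K^o) => e e0.
  by apply: le_trans (fP _ u) _; rewrite subrr rnorm0 mulr0 ltW.
apply/ler_addgt0Pl => e e0; have [|u zu] := approx z (e / 3); first by rewrite divr_gt0.
have := absD (f z - phi u) (phi u); rewrite subrK => h.
have := fP z u; have := phi_le u; have := rnorm_triangle z (j u) 0.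
by rewrite !subr0 (rnorm_distC (j u)); lra.
Qed.

End Extension.

(** * Finite sums of tensors on which a product functional is nearly maximal *)

Section TensorSums.
Variables (R : realType) (k : scalar_kind).
Local Notation K := (scalars R k).
Variables (X Y Z : normedModType K) (iota : {linear tensor X Y -> Z}).
Local Notation T x y := (iota (tens x y)).

Lemma tensBl (x1 x2 : X) (y : Y) : tens (x1 - x2) y = tens x1 y - tens x2 y.
Proof. by rewrite tensDl -scaleN1r tensZl scaleN1r. Qed.

Lemma tensBr (x : X) (y1 y2 : Y) : tens x (y1 - y2) = tens x y1 - tens x y2.
Proof. by rewrite tensDr -scaleN1r tensZr scaleN1r. Qed.

Lemma tens_sumr (x : X) n (y : 'I_n -> Y) (P : pred 'I_n) :
  tens x (\sum_(i < n | P i) y i) = \sum_(i < n | P i) tens x (y i).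
Proof.
apply: (big_morph (tens x)); first exact: tensDr.
by rewrite -(scale0r 0) tensZr scale0r.
Qed.

Hypothesis T_le : forall x y, rnorm (T x y) <= rnorm x * rnorm y.

Variables (f : {linear X -> K^o}) (h : {linear Y -> K^o}).
Hypothesis f_le : forall x, scalar_abs (f x) <= rnorm x.
Hypothesis h_le : forall y, scalar_abs (h y) <= rnorm y.

Variables (a : X) (g e : R).
Hypotheses (a1 : unit_ball X a) (g0 : 0 < g) (g1 : g <= 1) (e0 : 0 <= e).
Hypothesis cap_near : forall x, cap f g x -> rnorm (x - a) <= e.

(** The absolute values of both functionals are nearly maximal, because their
    product is. The scalar that makes the value of [f] real positive is moved
    over to the second factor, so that the normalized first factor lies in the
    small slice around [a]; then the value of [h] has a large real part too. *)
Lemma elementary_tensor_near x y :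
  (1 - g) * (rnorm x * rnorm y) < scalar_re (f x * h y) ->
  exists y', [/\ unit_ball Y y', 1 - g < scalar_re (h y') &
    rnorm (T x y - real_scalar (rnorm x * rnorm y) *: T a y')
      <= (rnorm x * rnorm y) * e].
Proof.
move=> lt_xy; set w := rnorm x * rnorm y.
have xge0 := rnorm_ge0 x; have yge0 := rnorm_ge0 y.
have fh_le : scalar_re (f x * h y) <= scalar_abs (f x) * scalar_abs (h y).
  by rewrite -scalar_absM scalar_re_le.
have fge0 : 0 <= scalar_abs (f x) by exact: (@rnorm_ge0 R k K^o).
have fx := f_le x; have hy := h_le y.
have fy : (1 - g) * (rnorm x * rnorm y) < scalar_abs (f x) * rnorm y.
  by apply: lt_le_trans lt_xy (le_trans fh_le _); rewrite ler_wpM2l.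
have ygt0 : 0 < rnorm y.
  by rewrite lt_def yge0 andbT; apply: contraTneq fy => ->; rewrite !mulr0 ltxx.
have fx_gt : (1 - g) * rnorm x < scalar_abs (f x).
  by rewrite -(ltr_pM2r ygt0) -mulrA.
have xgt0 : 0 < rnorm x.
  rewrite lt_def xge0 andbT; apply: contraTneq fx_gt => x0.
  by rewrite x0 mulr0 -leNgt -x0.
have w0 : 0 < w by rewrite mulr_gt0.
have [t t1 tf] := scalar_phase (f x).
have t0 : t != 0 by rewrite -normr_eq0 t1 oner_eq0.
have abst : scalar_abs t = 1 by rewrite /scalar_abs t1 scalar_re1.
have abstV : scalar_abs t^-1 = 1.
  by rewrite /scalar_abs normfV t1 invr1 scalar_re1.
pose x' := real_scalar (rnorm x)^-1 *: (t *: x).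
pose y' := real_scalar (rnorm y)^-1 *: (t^-1 *: y).
have x'1 : rnorm x' = 1.
  by rewrite rnormZ_real ?invr_ge0 // rnormZ abst mul1r mulVf ?gt_eqF.
have y'1 : rnorm y' = 1.
  by rewrite rnormZ_real ?invr_ge0 // rnormZ abstV mul1r mulVf ?gt_eqF.
have scal1 : real_scalar (rnorm x)^-1 * t * real_scalar (rnorm y)^-1 / t * real_scalar w = 1.
  rewrite (mulrAC _ _ t^-1) mulfK // -!real_scalarM.
  by rewrite -invfM mulVf ?real_scalar1 // gt_eqF.
have TE : T x y = real_scalar w *: T x' y'.
  by rewrite /x' /y' !tensZl !tensZr !linearZ /= !scalerA scal1 scale1r.
have fx' : f x' = real_scalar (scalar_abs (f x) / rnorm x).
  by rewrite /x' !functionalZ tf -real_scalarM mulrC.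
have p_gt : 1 - g < scalar_abs (f x) / rnorm x by rewrite ltr_pdivlMr.
have p_le : scalar_abs (f x) / rnorm x <= 1 by rewrite ler_pdivrMr // mul1r.
have hy' : scalar_abs (f x) / rnorm x * scalar_re (h y') = scalar_re (f x * h y) / w.
  rewrite -scalar_reM -fx' [RHS]mulrC -scalar_reM /x' /y' !functionalZ.
  by rewrite mulrACA -real_scalarM -invfM mulrACA divff // mul1r.
exists y'; split; first by rewrite /unit_ball /= y'1.
- have : 1 - g < scalar_re (f x * h y) / w by rewrite ltr_pdivlMr.
  rewrite -hy' => lt_ph; have [h0|h0] := leP 0 (scalar_re (h y')).
    by apply: lt_le_trans lt_ph _; rewrite ler_piMl.
  have : scalar_abs (f x) / rnorm x * scalar_re (h y') <= 0.
    by rewrite mulr_ge0_le0 ?divr_ge0 // ltW.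
  by move=> /(lt_le_trans lt_ph); rewrite subr_lt0 ltNge g1.
rewrite TE -scalerBr -linearB -tensBl rnormZ_real ?(ltW w0) // ler_pM2l //.
apply: le_trans (T_le _ _) _; rewrite y'1 mulr1 cap_near //.
by split; [rewrite /unit_ball /= x'1 | rewrite fx' scalar_re_real].
Qed.

(** Call [w i] the weight of the i-th tensor. The tensors on which the product
    functional is at most [(1 - g) * w i] have total weight at most [3 * d],
    as each unit of their weight costs [g] out of a total loss of [3 * g * d].
    The others are close to [w i] times a tensor of [a] with a point of the
    slice of [Y], and the weighted mean of these points is the required one;
    their total weight differs from 1 by at most [5 * d]. *)
Lemma sum_tensor_near n (x : 'I_n -> X) (y : 'I_n -> Y) (d : R) :
  0 < d -> 5 * d < 1 ->
  \sum_(i < n) rnorm (x i) * rnorm (y i) <= 1 + g * d ->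
  1 - 2 * (g * d) <= scalar_re (\sum_(i < n) f (x i) * h (y i)) ->
  exists y0, [/\ unit_ball Y y0, 1 - g <= scalar_re (h y0) &
    rnorm (\sum_(i < n) T (x i) (y i) - T a y0) <= 2 * e + 8 * d].
Proof.
move=> d0 d5 w_le re_ge.
pose w i := rnorm (x i) * rnorm (y i); pose v i := scalar_re (f (x i) * h (y i)).
pose G i := (1 - g) * w i < v i.
have w0 i : 0 <= w i by rewrite mulr_ge0 ?rnorm_ge0.
have v_le i : v i <= w i.
  apply: le_trans (scalar_re_le _) _; rewrite scalar_absM.
  by apply: ler_pM => //; exact: (@rnorm_ge0 R k K^o).
have /choice[y' y'P] i : exists y', G i -> [/\ unit_ball Y y', 1 - g < scalar_re (h y') &
    rnorm (T (x i) (y i) - real_scalar (w i) *: T a y') <= w i * e].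
  case: (boolP (G i)) => [/elementary_tensor_near[z zP]|_]; last by exists 0.
  by exists z.
set WG := \sum_(i < n | G i) w i; set WB := \sum_(i < n | ~~ G i) w i.
have WE : WG + WB <= 1 + g * d by move: w_le; rewrite (bigID G).
have WB0 : 0 <= WB by rewrite sumr_ge0.
have VE : 1 - 2 * (g * d) <= WG + (1 - g) * WB.
  apply: le_trans re_ge _; rewrite scalar_re_sum (bigID G) /= lerD //.
    by apply: ler_sum => i _; exact: v_le.
  by rewrite mulr_sumr; apply: ler_sum => i; rewrite -leNgt.
have gd : g * d <= d by rewrite ler_piMl // ltW.
have WBd : WB <= 3 * d.
  by rewrite -(ler_pM2l g0); lra.
have gWB : 0 <= g * WB by rewrite mulr_ge0 // ltW.
have WGpos : 0 < WG by lra.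
pose y0 := real_scalar WG^-1 *: \sum_(i < n | G i) real_scalar (w i) *: y' i.
have WGy : real_scalar WG *: T a y0 = \sum_(i < n | G i) real_scalar (w i) *: T a (y' i).
  rewrite /y0 tensZr linearZ /= scalerA -real_scalarM divff ?gt_eqF // real_scalar1.
  rewrite scale1r tens_sumr linear_sum; apply: eq_bigr => i _.
  by rewrite tensZr linearZ.
have y0_1 : rnorm y0 <= 1.
  rewrite rnormZ_real ?invr_ge0 ?(ltW WGpos) // ler_pdivrMl // mulr1.
  apply: le_trans (rnorm_sum _ _) _; apply: ler_sum => i Gi.
  have [yi1 _ _] := y'P i Gi.
  by rewrite rnormZ_real // ler_piMr.
exists y0; split => //.
  rewrite functionalZ scalar_reM ler_pdivlMl // linear_sum /=.
  rewrite (big_morph _ (@scalar_reD R k) (scalar_re0 R k)) mulr_suml.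
  apply: ler_sum => i Gi; have [_ /ltW hi _] := y'P i Gi.
  by rewrite functionalZ scalar_reM ler_wpM2l.
have Ta : rnorm (T a y0) <= 1.
  by apply: le_trans (T_le _ _) _; rewrite mulr_ile1 ?rnorm_ge0.
have splitE : \sum_(i < n) T (x i) (y i) - T a y0 =
   \sum_(i < n | G i) (T (x i) (y i) - real_scalar (w i) *: T a (y' i)) +
   (\sum_(i < n | ~~ G i) T (x i) (y i) + real_scalar (WG - 1) *: T a y0).
  rewrite (bigID G) /= big_split /= sumrN -WGy real_scalarD real_scalarN real_scalar1.
  rewrite scalerBl scale1r -!addrA; congr (_ + _); rewrite addrCA; congr (_ + _).
  by rewrite addrA addNr add0r.
have near : rnorm (\sum_(i < n | G i)
    (T (x i) (y i) - real_scalar (w i) *: T a (y' i))) <= WG * e.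
  apply: le_trans (rnorm_sum _ _) _; rewrite mulr_suml; apply: ler_sum => i Gi.
  by have [_ _] := y'P i Gi.
have bad : rnorm (\sum_(i < n | ~~ G i) T (x i) (y i)) <= WB.
  by apply: le_trans (rnorm_sum _ _) _; apply: ler_sum => i _; exact: T_le.
have rest : rnorm (real_scalar (WG - 1) *: T a y0) <= 5 * d.
  rewrite rnormZ scalar_abs_real.
  have : `|WG - 1| <= 5 * d by rewrite ler_norml; apply/andP; split; lra.
  have := rnorm_ge0 (T a y0); have := normr_ge0 (WG - 1); nra.
rewrite splitE; apply: le_trans (rnormD _ _) _.
apply: le_trans (lerD near (rnormD _ _)) _.
have : WG * e <= 2 * e by rewrite ler_wpM2r //; lra.
by lra.
Qed.

End TensorSums.

(** * Slices of the ball of the projective tensor product *)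

Section ProjectiveSlices.
Variables (R : realType) (k : scalar_kind).
Local Notation K := (scalars R k).
Variables (X Y : normedModType K) (Z : completeNormedModType K).
Variable iota : {linear tensor X Y -> Z}.
Hypothesis hZ : is_proj_tensor iota.
Local Notation T x y := (iota (tens x y)).

Lemma rnorm_tens_le x y : rnorm (T x y) <= rnorm x * rnorm y.
Proof.
rewrite hZ.1; apply: ge_inf; last first.
  by exists 1%N, (fun=> x), (fun=> y); rewrite !big_ord1.
exists 0 => _ [n [xs [ys [_ ->]]]]; apply: sumr_ge0 => i _.
by rewrite mulr_ge0 ?rnorm_ge0.
Qed.

Lemma proj_tensor_sum u (r : R) : rnorm (iota u) < r ->
  exists n (x : 'I_n -> X) (y : 'I_n -> Y),
    u = \sum_(i < n) tens (x i) (y i) /\ \sum_(i < n) rnorm (x i) * rnorm (y i) < r.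
Proof.
rewrite hZ.1 => /inf_lt[|_ [n [x [y [uE ->]]]] lt_r]; last by exists n, x, y.
by have [n [x [y uE]]] := tens_span u; eexists; exists n, x, y.
Qed.

Lemma proj_tensor_approx z (e : R) : 0 < e -> exists u, rnorm (z - iota u) < e.
Proof.
by move=> e0; have [_ [u _ <-] ?] := dense_rnormP hZ.2 z e0; exists u.
Qed.

(** Bounding the product functional on one representation at a time bounds it
    by the projective norm, which is the infimum over all representations; this
    is what the extension to the completion needs. The norm is not smaller than
    one since the product is almost 1 on suitable elementary tensors. *)
Lemma product_functional (f : {linear X -> K^o}) (h : {linear Y -> K^o}) :
  unit_functional f -> unit_functional h ->
  exists F : {linear Z -> K^o}, unit_functional F /\
    forall x y, F (T x y) = f x * h y.
Proof.
move=> uf uh.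
have bil : bilinear_for *:%R *:%R (fun x y => f x * h y : K^o).
  split=> [y c x1 x2|x c y1 y2] /=; rewrite linearD functionalZ.
    by rewrite [LHS]mulrDl -mulrA.
  by rewrite [LHS]mulrDr mulrCA.
have [phi phiE] := tens_lift bil.
have [u|F [FE F_le]] := dense_extension (phi := phi) hZ.2.
  apply/ler_addgt0Pl => e e0.
  have [|n [x [y [-> lt_e]]]] := @proj_tensor_sum u (e + rnorm (iota u)).
    by rewrite ltrDr.
  rewrite linear_sum; apply: le_trans (ltW lt_e).
  apply: le_trans (@rnorm_sum R k K^o _ _ _) _; apply: ler_sum => i _.
  rewrite phiE [rnorm _]scalar_absM.
  by apply: ler_pM; rewrite ?uf.1 ?uh.1 //; exact: (@rnorm_ge0 R k K^o).
exists F; split=> [|x y]; last by rewrite FE phiE.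
split=> // e e0; pose d := Num.min (e / 2) 1.
have [d0 d1 de] : [/\ 0 < d, d <= 1 & 2 * d <= e].
  by rewrite /d; split; rewrite ?lt_min ?ge_min ?lexx ?orbT ?divr_gt0 ?ltr01 //
    -ler_pdivlMl // mulrC ge_min lexx.
have [x x1 fx] := uf.2 d d0; have [y y1 hy] := uh.2 d d0.
(* The rotation makes the first factor real, so that real parts multiply. *)
have [t t1 tf] := scalar_phase (f x); exists (T (t *: x) y).
  apply: le_trans (rnorm_tens_le _ _) _; rewrite rnormZ /scalar_abs t1 scalar_re1 mul1r.
  by rewrite mulr_ile1 ?rnorm_ge0.
rewrite FE phiE functionalZ tf scalar_reM.
have := scalar_re_le (f x); nra.
Qed.

(** The depth [g * d] of the new slice has two factors: [g] is so small that
    the caps of depth [g] lie in the given ones, and [d] makes the errors of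
    [sum_tensor_near] small compared with [e]. *)
Lemma cap_tensor_slice (a : X) (f : {linear X -> K^o}) (h : {linear Y -> K^o}) (s t e : R) :
  unit_ball X a -> unit_functional f -> unit_functional h ->
  0 < s -> 0 < t -> 0 < e -> (forall x, cap f s x -> rnorm (x - a) <= e / 8) ->
  exists S, is_slice (unit_ball Z) S /\
    forall z, S z -> exists2 y, cap h t y & rnorm (z - T a y) <= e.
Proof.
move=> a1 uf uh s0 t0 e0 near_a.
pose g := Num.min (Num.min s (t / 2)) 1; pose d := Num.min (e / 16) (1 / 6).
have [g0 gs gt g1] : [/\ 0 < g, g <= s, g < t & g <= 1].
  have : g <= t / 2 by rewrite /g !ge_min lexx orbT.
  by split; rewrite ?lt_min ?ge_min ?lexx ?orbT ?s0 ?divr_gt0 ?ltr01 //; lra.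
have [d0 de d6] : [/\ 0 < d, d <= e / 16 & d <= 1 / 6].
  by rewrite lt_min !ge_min !lexx orbT !divr_gt0.
have [F [uF FE]] := product_functional uf uh.
have gd0 : 0 < g * d by rewrite mulr_gt0.
have gd : g * d <= d by rewrite ler_piMl // ltW.
exists (cap F (g * d)); split=> [|z [z1 Fz]]; first exact: cap_slice.
have [u zu] := proj_tensor_approx z gd0.
have [|n [x [y [uE w_lt]]]] := @proj_tensor_sum u (1 + g * d).
  have := rnorm_triangle (iota u) z 0; have := rnorm_triangle z (iota u) 0.
  by move: z1; rewrite /unit_ball /= !subr0 (rnorm_distC (iota u)); lra.
have re_u : 1 - 2 * (g * d) <= scalar_re (\sum_(i < n) f (x i) * h (y i)).
  have <- : F (iota u) = \sum_(i < n) f (x i) * h (y i).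
    by rewrite uE !linear_sum; apply: eq_bigr => i _; rewrite FE.
  have := scalar_re_le (F (z - iota u)); have := uF.1 (z - iota u).
  by rewrite linearB scalar_reD scalar_reN; lra.
have cap_a w : cap f g w -> rnorm (w - a) <= e / 8.
  by case=> w1 fw; apply: near_a; split=> //; lra.
have e8 : 0 <= e / 8 by rewrite divr_ge0 // ltW.
have d5 : 5 * d < 1 by lra.
have [y0 [y01 hy0 near0]] := sum_tensor_near rnorm_tens_le uf.1 uh.1 a1 g0 g1 e8
  cap_a d0 d5 (ltW w_lt) re_u.
exists y0; first by split=> //; lra.
have uT : \sum_(i < n) T (x i) (y i) = iota u by rewrite uE linear_sum.
rewrite uT in near0; apply: le_trans (rnorm_triangle (iota u) _ _) _.
apply: le_trans (lerD (ltW zu) near0) _; lra.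
Qed.

(** In the main case the small slice around [a] is a cap, and the product
    functional does the rest. *)
Lemma denting_tensor_slice (a : X) (h : {linear Y -> K^o}) (t e : R) :
  dent (unit_ball X) a -> unit_functional h -> 0 < t -> 0 < e ->
  exists S, is_slice (unit_ball Z) S /\
    forall z, S z -> exists2 y, cap h t y & rnorm (z - T a y) <= e.
Proof.
move=> [a1 dent_a] uh t0 e0; pose e' := Num.min (e / 8) (1 / 4).
have [e'0 e'e e'1] : [/\ 0 < e', e' <= e / 8 & e' <= 1 / 4].
  by rewrite lt_min !ge_min !lexx orbT !divr_gt0.
have [S [sliceS Sa diamS]] := dent_a e' e'0.
have near_a x : S x -> rnorm (x - a) <= e'.
  move=> Sx; rewrite -lee_fin; apply: le_trans diamS.
  by apply: ereal_sup_ubound; exists (x, a).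
have [SE|[f [s [uf s0 SE]]]] := ball_sliceP sliceS; last first.
  apply: (cap_tensor_slice a1 uf uh s0 t0 e0) => x.
  by rewrite -SE => /near_a near_x; exact: le_trans near_x e'e.
(* The whole ball of [X] is close to [a]; then [X] is trivial, and so is [Z]. *)
have X0 (x : X) : x = 0.
  have [//|x0] := eqVneq (rnorm x) 0; first exact: rnorm_eq0.
  have [u u1] : exists u : X, rnorm u = 1.
    exists (real_scalar (rnorm x)^-1 *: x).
    by rewrite rnormZ_real ?invr_ge0 ?rnorm_ge0 // mulVf.
  exfalso; have /near_a ua : S u by rewrite SE /unit_ball /= u1.
  have /near_a za : S 0 by rewrite SE; exact: unit_ball0.
  have := rnorm_triangle a u 0; rewrite (rnorm_distC a) subr0; lra.
have Z0 (z : Z) : z = 0.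
  apply: rnorm_small0 => r r0; have [u zu] := proj_tensor_approx z r0.
  have [n [x [y uE]]] := tens_span u; suff u0 : u = 0.
    by move: zu; rewrite u0 linear0 subr0 => /ltW.
  rewrite uE big1 // => i _; rewrite (X0 (x i)).
  by rewrite -(scale0r (0 : X)) tensZl scale0r.
exists (unit_ball Z); split=> [|z _]; first exact: ball_slice.
have [y y1 hy] := uh.2 t t0; exists y => //.
by rewrite (Z0 (z - _)) rnorm0 ltW.
Qed.

End ProjectiveSlices.

(** * Determining sequences *)

(** If all members were the whole ball, the singleton of 0 would meet them all
    and force [b = 0]. So some member is a cap, and it serves for the members
    that are the whole ball. *)
Lemma determining_cap (R : realType) (k : scalar_kind)
    (Y : normedModType (scalars R k)) (b : Y) (V : nat -> set Y) :
  b <> 0 -> (forall n, is_slice (unit_ball Y) (V n)) ->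
  determining (unit_ball Y) b V ->
  forall n, exists f t, [/\ unit_functional f, 0 < t & cap f t `<=` V n].
Proof.
move=> b0 sliceV [_ detV].
have [m Vm] : exists m, V m <> unit_ball Y.
  apply: contrapT => allV; apply: b0.
  have V0 n : V n 0.
    rewrite (_ : V n = unit_ball Y); first exact: unit_ball0.
    by apply: contrapT => Vn; apply: allV; exists n.
  have /closure_rnormP cl : closure (conv_hull [set 0]) b.
    by apply: detV => [_ ->|n]; [exact: unit_ball0 | exists 0].
  apply: rnorm_small0 => e e0; have [y hull_y] := cl e e0.
  suff -> : y = 0 by rewrite subr0 => /ltW.
  apply: (@smallest_sub _ (@convex_set _ Y) [set 0] [set 0] _ _ y hull_y) => // u v l.
  by rewrite !inE => -> ->; rewrite convmm.
have [/Vm //|[f [t [uf t0 _]]]] := ball_sliceP (sliceV m).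
move=> n; have [->|[g [s [ug s0 ->]]]] := ball_sliceP (sliceV n); last first.
  by exists g, s; split=> // y.
by exists f, t; split=> // y [].
Qed.

(** Convexity makes this set contain the hull of any set of [y] that it
    contains: approximations of the generators by points of [B] pass to convex
    combinations without any computation with coefficients. *)
Lemma convex_near_image (R : realType) (k : scalar_kind)
    (Y Z : normedModType (scalars R k)) (L : {linear Y -> Z}) (B : set Z) (e : R) :
  convex_set ([set y | exists2 z, conv_hull B z & rnorm (z - L y) <= e] : set Y).
Proof.
move=> y1 y2 l; rewrite !inE => -[z1 Bz1 zy1] [z2 Bz2 zy2].
pose z : Z := conv l (z1 : convex_lmodType Z) (z2 : convex_lmodType Z).
exists z.
  move=> C [cC BC]; apply/set_mem; apply: (cC); apply/mem_set.
    exact: Bz1 C (conj cC BC).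
  exact: Bz2 C (conj cC BC).
have l0 : 0 <= l%:num by [].
have l1 : 0 <= 1 - l%:num by rewrite subr_ge0.
rewrite [z - _](_ : _ = l%:num *: (z1 - L y1) + (1 - l%:num) *: (z2 - L y2)); last first.
  rewrite /z /conv /= linearD !linearZ /= !scalerBr addrACA opprD //.
apply: le_trans (rnormD _ _) _.
rewrite !rnormZ !ger0_scalar_abs // scalar_reD scalar_reN scalar_re1.
have p0 : 0 <= scalar_re l%:num by rewrite -(@ler_real_scalar R k) real_scalar0 -ger0_real_scalar.
have p1 : 0 <= 1 - scalar_re l%:num.
  by rewrite -(@scalar_re1 R k) -scalar_reN -scalar_reD -(@ler_real_scalar R k) real_scalar0 -ger0_real_scalar.
nra.
Qed.

Theorem theorem4p1 (R : realType) (k : scalar_kind)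
  (X Y : completeNormedModType (scalars R k))
  (Z : completeNormedModType (scalars R k))
  (iota : {linear tensor X Y -> Z}) (hZ : is_proj_tensor iota)
  (a : X) (b : Y)
  (ha : dent (unit_ball X) a)
  (hb : (SCD (unit_ball Y) `\` [set 0]) b) :
  SCD (unit_ball Z) (iota (tens a b)).
Proof.
have [[b1 [V [sliceV detV]]] b0] := hb; have [a1 _] := ha.
have T_le := rnorm_tens_le hZ.
(* Passing to a smaller [cap f t] handles the members [V n] that are the ball. *)
have /choice[W WP] (p : nat * nat) : exists S, is_slice (unit_ball Z) S /\
    forall z, S z -> exists2 y, V p.1 y & rnorm (z - iota (tens a y)) <= p.2.+1%:R^-1.
  have [f [t [uf t0 capV]]] := determining_cap b0 sliceV detV p.1.
  have [|S [sliceS near_S]] := denting_tensor_slice hZ (e := p.2.+1%:R^-1) ha uf t0.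
    by rewrite invr_gt0.
  by exists S; split=> // z /near_S[y /capV Vy]; exists y.
split.
  by apply: le_trans (T_le _ _) _; rewrite mulr_ile1 ?rnorm_ge0.
(* The default pair is never used at codes of pairs, the only ones that matter. *)
exists (fun n => W (odflt (0, 0)%N (unpickle n))); split=> [n|]; first exact: (WP _).1.
split=> [n|B B1 meetB].
  have [W0 [f [_ [t _ WE]]]] := (WP (odflt (0, 0)%N (unpickle n))).1.
  by split=> //; rewrite WE => z [].
pose L y := iota (tens a y).
have L_lin : linear L by move=> c y1 y2; rewrite /L tensDr tensZr linearP.
pose L' : {linear Y -> Z} := HB.pack L (GRing.isLinear.Build _ Y Z *:%R L L_lin).
apply/closure_rnormP => e e0.
have [m lt_m] : exists m, m.+1%:R^-1 < e / 2.
  have [|m] := @ltr_add_invr R 0 (e / 2); first by rewrite divr_gt0.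
  by rewrite add0r => lt_m; exists m.
have /choice[z zP] n : exists z, B z /\ W (n, m) z.
  by have := meetB (pickle (n, m)); rewrite pickleK.
have /choice[y yP] n : exists y, V n y /\ rnorm (z n - L y) <= m.+1%:R^-1.
  by have [y ? ?] := (WP (n, m)).2 _ (zP n).2; exists y.
have /closure_rnormP/(_ (e / 2)) : closure (conv_hull (range y)) b.
  apply: detV.2 => [_ [n _ <-]|n]; first exact: (detV.1 n).1 (yP n).1.
  by exists (y n); split; [exists n | exact: (yP n).1].
case=> [|y0 hull_y0 by0]; first by rewrite divr_gt0.
have near_hull : range y `<=` [set y1 | exists2 z1, conv_hull B z1 &
    rnorm (z1 - L' y1) <= m.+1%:R^-1].
  move=> _ [n _ <-]; exists (z n); last exact: (yP n).2.
  by apply: sub_gen_smallest; exact: (zP n).1.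
have [z0 Bz0 z0y0] := smallest_sub (@convex_near_image R k Y Z L' B _) near_hull hull_y0.
exists z0 => //.
have b_y0 : rnorm (iota (tens a b) - L y0) <= rnorm (b - y0).
  rewrite /L -linearB -tensBr; apply: le_trans (T_le _ _) _.
  by rewrite ler_piMl ?rnorm_ge0.
apply: le_lt_trans (rnorm_triangle (L y0) _ _) _.
have z0y0' : rnorm (L y0 - z0) <= m.+1%:R^-1 by rewrite rnorm_distC; exact: z0y0.
by apply: le_lt_trans (lerD b_y0 z0y0') _; rewrite [e]splitr ltrD.
Qed.
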